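(* Let $q$ be a prime power, $n\geq 1$, and let $f(y)=\sum_{i=0}^{d}c_iy^{q^i}\in\mathbb{F}_{q^n}[y]$ with $c_d\neq 0$ be an $\mathbb{F}_q$-linearised polynomial of $q$-degree $d$. Consider the subsets of the projective line $\mathrm{PG}(1,q^n)$ $$C_1=\{(x,\mathrm{Tr}(x))_{q^n}\mid x\in\mathbb{F}_{q^n}^*\},\qquad C_2=\{(f(y),y)_{q^n}\mid y\in\mathbb{F}_{q^n}^*\}.$$ If $d<n/2-1$, then $C_1$ and $C_2$ have at least one point in common.
   Context: $\mathrm{Tr}=\mathrm{Tr}_{\mathbb{F}_{q^n}/\mathbb{F}_q}$. For a nonzero vector $(u_0,u_1)\in\mathbb{F}_{q^n}^2$, $(u_0,u_1)_{q^n}$ denotes the projective point of $\mathrm{PG}(1,q^n)=\mathbb{P}(\mathbb{F}_{q^n}^2)$ spanned by it, i.e. the set of its nonzero $\mathbb{F}_{q^n}$-multiples.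
   Formalization: The formal theorem also assumes d ≥ 1; for d = 0 the claim fails, since f(y) = c_0 y with c_0 ≠ 0 and Tr(c_0) = 0 gives C_2 = {(c_0,1)}, which is disjoint from C_1, although 0 < n/2 − 1 for n ≥ 3. *)

(* Defs.v *)
From mathcomp Require Import all_boot all_order all_algebra all_fingroup all_field.

Set Implicit Arguments.
Unset Strict Implicit.
Unset Printing Implicit Defensive.

Import GRing.Theory.
Local Open Scope ring_scope.

(* A point of PG(1,K) is the set of nonzero multiples of a nonzero vector; for
   u = (0, 0) the value is the junk singleton {(0, 0)}. *)
Definition proj_point (K : finFieldType) (u : K * K) : {set K * K} :=
  [set (a * u.1, a * u.2) | a : K & a != 0].

Definition linearised_poly (K : nzRingType) (q d : nat) (c : 'I_d.+1 -> K) :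
  {poly K} := \sum_(i < d.+1) c i *: 'X^(q ^ i).

(* Below F = F_q and L is an extension of degree n. An abstract
   [fieldExtType F] is not a finType; its alias [finvect_type L] is the same
   field with the finite field and splitting field (hence Galois) structures. *)
Definition Tr (F : finFieldType) (L : fieldExtType F) (x : finvect_type L) :
  finvect_type L := galTrace 1%AS {: finvect_type L}%AS x.

(* L is explicit since unification could otherwise wrap the alias twice. *)
Arguments Tr {F} L x.

Definition trace_points (F : finFieldType) (L : fieldExtType F) :
  {set {set finvect_type L * finvect_type L}} :=
  [set proj_point (x, Tr L x) | x : finvect_type L & x != 0].

Definition graph_points (K : finFieldType) (f : {poly K}) : {set {set K * K}} :=
  [set proj_point (f.[y], y) | y : K & y != 0].

(* Main.v *)
(** A common point amounts to some y != 0 with Tr (f y / y) = 1. If there were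
none, (Tr (f y / y) - 1) ^ (q - 1) would be 1 for all y != 0. But Tr (f y / y)
is the sum over i and j of
  c_i ^ (q ^ j) * y ^ ((q - 1) * (q ^ j + q ^ (j + 1) + ... + q ^ (j + i - 1))).
Up to the factor q - 1, the exponents in the expansion of the (q - 1)-st power
are thus numbers written in base q whose digit at position a counts how many of
at most q - 1 cyclic arcs of length at most d in Z/n contain a. They only matter
modulo R = 1 + q + ... + q ^ (n - 1).
Put about half of the q - 1 arcs on [0, d) and the other half on [1, d + 1), and
let M0 be the resulting number. For 0 < t < q - 1 the digits of M0 + t * R, found
by following the carries, oscillate too much around the circle to be counts of
at most q - 1 arcs, since every arc is entered and left only once (if d = 1, they
are too large instead). Hence M0 is reached only by distributing the q - 1
factors over those two arcs, and its coefficient is a product of powers of c_d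
and a binomial coefficient 'C(q - 1, k), which is (-1) ^ k in characteristic p.
This is not zero, a contradiction. *)

Require Import Defs.
From mathcomp Require Import all_boot all_order all_algebra all_fingroup all_field.
From mathcomp Require Import zify.

Set Implicit Arguments.
Unset Strict Implicit.
Unset Printing Implicit Defensive.

(** * Cyclic arcs and carries in base q *)

(* Membership of a < n in the arc {j, ..., j + i - 1} of Z/n, where j < n and i <= n. *)
Definition in_arc n j i a := (j <= a < j + i) || (a + n < j + i).

(** Since [i <= n], the residues on the left are distinct and fill the arc. *)
Lemma sum_arc n j i (F : nat -> nat) : j < n -> i <= n ->
  \sum_(k < i) F ((j + k) %% n) = \sum_(a < n | in_arc n j i a) F a.
Proof.
move=> ltjn; elim: i => [_|i IHi ltin].
  by rewrite big_ord0 big1 // => a; rewrite /in_arc; lia.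
have n_gt0 : 0 < n by lia.
have Dm : (j + i) %% n = if j + i < n then j + i else j + i - n.
  case: ifP => [/modn_small //|/negbT]; rewrite -leqNgt => le_n.
  by rewrite -{1}(subnK le_n) modnDr modn_small //; lia.
rewrite big_ord_recr /= IHi; last lia.
rewrite [RHS](bigD1 (Ordinal (ltn_pmod (j + i) n_gt0))) /=; last first.
  by rewrite Dm /in_arc; case: ifP; lia.
rewrite addnC; congr (_ + _); apply: eq_bigl => a.
rewrite -val_eqE /= Dm /in_arc; have := ltn_ord a; case: ifP; lia.
Qed.

(* [c a] is the carry into position a when the digits [g], possibly exceeding q,
   are normalised to the digits [f]. *)
Lemma carries q n (f g : nat -> nat) c0 : (forall a, a < n -> f a < q) ->
    \sum_(a < n) f a * q ^ a = c0 + \sum_(a < n) g a * q ^ a ->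
  exists c, [/\ c 0 = c0, c n = 0 & forall a, a < n ->
                f a + q * c a.+1 = g a + c a].
Proof.
elim: n f g c0 => [|n IHn] f g c0 ltfq.
  by rewrite !big_ord0 addn0 => /esym->; exists (fun=> 0).
rewrite !big_ord_recl /= !muln1.
have q_gt0 : 0 < q by have := ltfq 0 isT; lia.
have shift h : \sum_(i < n) h (bump 0 i) * q ^ bump 0 i
    = q * \sum_(i < n) h i.+1 * q ^ i.
  by rewrite big_distrr; apply: eq_bigr => i _; rewrite /bump expnS mulnCA.
rewrite !shift => Efg; have lef0 : f 0 < q by apply: ltfq.
have Emod : (g 0 + c0) %% q = f 0.
  have := congr1 (modn^~ q) Efg; rewrite /= addnA [c0 + _]addnC.
  by rewrite 2![_ + q * _]addnC 2![q * _]mulnC 2!modnMDl [f 0 %% q]modn_small.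
have Ediv := divn_eq (g 0 + c0) q; rewrite Emod in Ediv.
(* The carry out of position 0 becomes the initial carry of the remaining digits. *)
have [||c [c_0 c_n cS]] := IHn (f \o succn) (g \o succn) ((g 0 + c0) %/ q).
- by move=> a; apply: (ltfq a.+1).
- apply/eqP; rewrite -(eqn_pmul2l q_gt0) mulnDr [q * (_ %/ _)]mulnC /=.
  apply/eqP; move: Efg Ediv; set A := \sum_(i < n) f _ * _; set B := \sum_(i < n) _.
  set X := _ %/ q * q.
  by set Y := q * A; set Z := q * B; lia.
exists (fun a => if a is b.+1 then c b else c0); split=> // -[_|a lta].
  by rewrite c_0 mulnC; lia.
exact: cS.
Qed.

Section Profile.
Variables (q n d w0 w1 : nat).
Hypotheses (q_gt1 : 1 < q) (d_gt0 : 0 < d) (ltdn : d.*2.+2 < n).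
Hypotheses (w01 : w0 + w1 = q.-1) (lew10 : w1 <= w0) (lew01 : w0 <= w1.+1).

(** Cover counts of [w0] arcs [0, d) and [w1] arcs [1, d + 1), that is, the digits of M0. *)
Definition profile a := w0 * (a < d) + w1 * (0 < a <= d).

(* The four-point hypothesis holds for the number of arcs through a point, as an
   arc through x and z but neither y nor w would be entered twice. *)
Lemma profile_shift (f : nat -> nat) t : t.+1 < q ->
    (forall a, a < n -> f a < q) ->
    (forall y x w z, y < x -> x < w -> w < z -> z < n ->
      (f x + f z <= q.-1 + (f y + f w)) /\ (f y + f w <= q.-1 + (f x + f z))) ->
    (d = 1 -> forall x z, x < z -> z < n -> f x + f z <= q.-1) ->
    \sum_(a < n) f a * q ^ a = \sum_(a < n) (profile a + t) * q ^ a ->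
  t = 0 /\ forall a, a < n -> f a = profile a.
Proof.
move=> lttq ltfq f4 f2 Ef.
have [c [c_0 _ cS]] : exists c, [/\ c 0 = 0, c n = 0 & forall a, a < n ->
    f a + q * c a.+1 = profile a + t + c a] by apply: carries.
(* Carries stay at most 1, because (q - 1) + (q - 2) + 1 < 2 * q. *)
have lec a : a <= n -> c a <= 1.
  elim: a => [|a IHa ltan]; first by rewrite c_0.
  have := cS a ltan; have := IHa (ltnW ltan); have := ltfq a ltan.
  have : profile a <= q.-1 by rewrite /profile; case: ltnP; case: (_ < _ <= _); lia.
  case: (c a.+1) => [|[|k]] //; nia.
have cz a : a < n -> profile a + t + c a < q -> c a.+1 = 0.
  by move=> lta; rewrite -cS //; case: (c a.+1) => // k; nia.
have cp a : a < n -> q <= profile a + t + c a -> c a.+1 = 1.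
  move=> lta; rewrite -cS //; have := lec a.+1 lta; have := ltfq a lta.
  by case: (c a.+1) => [|[|k]] //; lia.
have pr0 : profile 0 = w0 by rewrite /profile d_gt0; lia.
have prm a : 0 < a < d -> profile a = q.-1.
  by rewrite /profile; case/andP => -> /[dup] /ltnW -> ->; lia.
have prd : profile d = w1 by rewrite /profile d_gt0 ltnn leqnn; lia.
have pro a : d < a -> profile a = 0.
  by rewrite /profile => lta; rewrite ltnNge (ltnW lta) [a <= d]leqNgt lta andbF /=; lia.
have [t0|t_gt0] := posnP t.
  split=> //; suff c0 a : a <= n -> c a = 0.
    by move=> a lta; have := cS a lta; rewrite t0 !c0 //; lia.
  elim: a => // a IHa lta; apply: cz => //; rewrite IHa ?t0; last lia.
  rewrite /profile; case: ltnP; case: (_ < _ <= _); lia.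
exfalso.
have f0 := cS 0 ltac:(lia); have fd := cS d ltac:(lia).
have fd1 := cS d.+1 ltac:(lia).
have c2 a : d.+1 < a -> a <= n -> c a = 0.
  case: a => // a lta ltan; apply: cz => //.
  by rewrite pro //; have := lec a (ltnW ltan); lia.
have fo a : d.+1 < a -> a < n -> f a = t.
  move=> lta ltan; have := cS a ltan.
  by rewrite pro ?c2 //; lia.
rewrite prd in fd; rewrite pro // (c2 d.+2) ?muln0 in fd1; try lia.
rewrite pr0 c_0 in f0.
have c1b := lec 1 ltac:(lia); have cdb := lec d.+1 ltac:(lia).
(* If d = 1, positions 3 and 4 both hold t, so 2 * t <= q - 1. Then positions 0 and 1 emit no carry,
   and [f 0 + f 1] is q - 1 + 2 * t, too large. *)
have [d1|d_neq1] := eqVneq d 1.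
  have fo3 := fo 3 ltac:(lia) ltac:(lia); have fo4 := fo 4 ltac:(lia) ltac:(lia).
  have := f2 d1 3 4 ltac:(lia) ltac:(lia).
  have := f2 d1 0 1 ltac:(lia) ltac:(lia).
  rewrite d1 in fd fd1 cdb; rewrite fo3 fo4.
  move: f0 fd fd1 cdb c1b; case: (c 1) => [|[|k]] //; case: (c 2) => [|[|k]] //; lia.
have cm a : 0 < a < d -> c a.+1 = 1 by move=> ha; apply: cp; rewrite ?prm //; lia.
have f1 := cS 1 ltac:(lia).
rewrite (prm 1) ?(cm 1) in f1; try lia.
have cd : c d = 1 by rewrite -(@prednK d) // cm; lia.
rewrite cd in fd.
have fn := fo n.-1 ltac:(lia) ltac:(lia).
(* Only the carries [c 1] and [c d.+1] are still open. The values (0, 0) violate [g2], (1, 1)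
   violates [g1], (0, 1) violates [g3] as [w1 <= w0], and (1, 0) would force [w0 >= w1 + 2]. *)
have [g1 _] := f4 0 1 d d.+1 ltac:(lia) ltac:(lia) ltac:(lia) ltac:(lia).
have [_ g2] := f4 0 1 d n.-1 ltac:(lia) ltac:(lia) ltac:(lia) ltac:(lia).
have [_ g3] := f4 0 d d.+1 n.-1 ltac:(lia) ltac:(lia) ltac:(lia) ltac:(lia).
have ltfdq : f d < q by apply: ltfq; lia.
move: f0 fd fd1 cdb c1b f1; case: (c 1) => [|[|k]] //; case: (c d.+1) => [|[|k]] //; lia.
Qed.
End Profile.

(** * Families of arcs with prescribed cover counts *)

Lemma sum_le1_eq (S : finType) (F : S -> nat) :
  (forall s, F s <= 1) -> \sum_s F s = #|S| -> forall s, F s = 1.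
Proof.
move=> leF1 /eqP; rewrite -sum1_card.
have := leqif_sum (fun s (_ : true) => leqif_eq (leF1 s)).
by move=> /leqifP; case: ifP => [/forallP/= allF _ _ s | _ /ltn_eqF->//]; apply/eqP/allF.
Qed.

(** Every arc contains all positions strictly between 0 and d, and none beyond d. No arc contains
    both 0 and d, while these are covered [#|S|] times in total, so each arc contains exactly one of
    them. *)
Lemma arcs_profile (S : finType) (j i : S -> nat) n d w0 w1 :
    0 < d -> d.*2.+2 < n -> w0 + w1 = #|S| ->
    (forall s, j s < n) -> (forall s, i s <= d) ->
    (forall a, a < n -> \sum_s in_arc n (j s) (i s) a = profile d w0 w1 a) ->
  (forall s, i s = d /\ j s <= 1) /\ \sum_s (j s == 0) = w0.
Proof.
move=> d_gt0 ltdn w01 ltjn leid Ej.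
have pr0 : profile d w0 w1 0 = w0 by rewrite /profile d_gt0; lia.
have prd : profile d w0 w1 d = w1 by rewrite /profile d_gt0 ltnn leqnn; lia.
have full a : 0 < a < d -> forall s, in_arc n (j s) (i s) a.
  case/andP=> a_gt0 ltad s.
  suff /eqP: in_arc n (j s) (i s) a = 1 :> nat by rewrite eqb1.
  move: s.
  apply: (@sum_le1_eq S (fun s => in_arc n (j s) (i s) a)) => [s'|]; first exact: leq_b1.
  rewrite Ej; last lia.
  by rewrite /profile a_gt0 ltad (ltnW ltad) /= !muln1.
have none a : d < a -> a < n -> forall s, ~~ in_arc n (j s) (i s) a.
  move=> ltda ltan s; have /eqP := Ej a ltan.
  rewrite /profile ltnNge (ltnW ltda) /= [a <= d]leqNgt ltda andbF !muln0.
  by rewrite sum_nat_eq0 => /forallP/(_ s); rewrite eqb0.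
have one s : in_arc n (j s) (i s) 0 + in_arc n (j s) (i s) d = 1.
  apply: (@sum_le1_eq S (fun s => in_arc n (j s) (i s) 0 + in_arc n (j s) (i s) d)) => [s'|].
    by have := ltjn s'; have := leid s'; rewrite /in_arc; lia.
  by rewrite big_split !Ej ?pr0 ?prd //; lia.
have ij s : i s = d /\ j s <= 1.
  have := none d.+1 ltac:(lia) ltac:(lia) s; have := none n.-1 ltac:(lia) ltac:(lia) s.
  have := one s; have := ltjn s; have := leid s.
  have [d1|d_neq1] := eqVneq d 1; first by rewrite d1 /in_arc; lia.
  have := full 1 ltac:(lia) s; have := full d.-1 ltac:(lia) s.
  by rewrite /in_arc; lia.
split=> //; rewrite -pr0 -Ej; last lia.
by apply: eq_bigr => s _; have [-> ?] := ij s; rewrite /in_arc; lia.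
Qed.

Lemma leq_sum_arc (S : finType) (j i : S -> nat) n x y z w :
    (forall s, in_arc n (j s) (i s) x + in_arc n (j s) (i s) z
            <= 1 + (in_arc n (j s) (i s) y + in_arc n (j s) (i s) w)) ->
  \sum_s in_arc n (j s) (i s) x + \sum_s in_arc n (j s) (i s) z
    <= #|S| + (\sum_s in_arc n (j s) (i s) y + \sum_s in_arc n (j s) (i s) w).
Proof.
by move=> le_arc; rewrite -sum1_card -!big_split; apply: leq_sum => s _; apply: le_arc.
Qed.

Lemma sum_arc_le (S : finType) (j i : S -> nat) n a :
  \sum_s in_arc n (j s) (i s) a <= #|S|.
Proof. by rewrite -sum1_card; apply: leq_sum => s _; apply: leq_b1. Qed.

(** The top digit of M0 is 0 and the others are at most q - 1, so M0 < q ^ (n - 1) <= R. *)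
Lemma profile_bounds q n d w0 w1 : 1 < q -> d.+1 < n -> w0 + w1 = q.-1 -> 0 < w0 -> 0 < d ->
  0 < q.-1 * \sum_(a < n) profile d w0 w1 a * q ^ a < (q ^ n).-1.
Proof.
case: n => // n q_gt1 ltdn w01 w0_gt0 d_gt0; rewrite predn_exp muln_gt0 ltn_pmul2l; last lia.
rewrite -andbA; apply/and3P; split; first lia.
  by rewrite big_ord_recl addn_gt0 /profile d_gt0 /=; lia.
rewrite !big_ord_recr /=.
have -> : profile d w0 w1 n = 0.
  rewrite /profile ltnNge (ltnW (ltdn : d < n)) /= [n <= d]leqNgt.
  by rewrite (ltdn : d < n) andbF !muln0.
have qn_gt0 : 0 < q ^ n by rewrite expn_gt0; lia.
rewrite mul0n addn0; apply: (@leq_ltn_trans (q ^ n).-1); last first.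
  by set X := \sum_(i < n) _; set Y := q ^ n in qn_gt0 *; lia.
rewrite predn_exp.
rewrite big_distrr /=; apply: leq_sum => a _; rewrite leq_mul2r.
by rewrite /profile; case: ltnP; case: (_ < _ <= _); lia.
Qed.

(** Dividing by q - 1 gives M = M0 + t * R with t = [k.-1], one multiple being absorbed by the
    subtraction. As M <= q ^ n - 1 and M0 > 0, t < q - 1 and [profile_shift] applies. *)
Lemma arcs_congr q n d w0 w1 (S : finType) (j i : S -> nat) :
    1 < q -> 0 < d -> d.*2.+2 < n -> w0 + w1 = q.-1 -> w1 <= w0 -> w0 <= w1.+1 ->
    #|S| = q.-1 -> (forall s, j s < n) -> (forall s, i s <= d) ->
    (q ^ n).-1 %| (q ^ n).-1 - q.-1 * \sum_(a < n) profile d w0 w1 a * q ^ a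
                + q.-1 * \sum_(a < n) (\sum_s in_arc n (j s) (i s) a) * q ^ a ->
  forall a, a < n -> \sum_s in_arc n (j s) (i s) a = profile d w0 w1 a.
Proof.
move=> q_gt1 d_gt0 ltdn w01 le10 le01 cardS ltjn leid.
pose f a := \sum_s in_arc n (j s) (i s) a.
rewrite -/(f _); under eq_bigr do rewrite -/(f _).
have /andP[] : 0 < q.-1 * \sum_(a < n) profile d w0 w1 a * q ^ a < (q ^ n).-1.
  by apply: profile_bounds; lia.
set M0 := \sum_(a < n) profile d w0 w1 a * q ^ a; set M := \sum_(a < n) f a * q ^ a.
move=> M0_gt0 ltM0 /dvdnP[k Ek].
have ltfq a : f a < q by have := sum_arc_le j i n a; rewrite cardS -/(f a); lia.
have leM : q.-1 * M <= q.-1 * (q ^ n).-1.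
  rewrite leq_mul2l predn_exp big_distrr; apply/orP; right.
  by apply: leq_sum => a _; rewrite leq_mul2r; have := ltfq a; lia.
have k_gt0 : 0 < k.
  by case: (k) Ek => // Ek0; move: Ek0 ltM0; set X := q.-1 * M0; set Y := q.-1 * M; lia.
have Ek1 : q.-1 * M = q.-1 * M0 + k.-1 * (q ^ n).-1.
  move: Ek; rewrite -{1}(prednK k_gt0) mulSn; set X := k.-1 * _.
  by set Y := q.-1 * M; set Z := q.-1 * M0 in M0_gt0 ltM0 *; lia.
have ltkq : k.-1 < q.-1.
  rewrite -(ltn_pmul2r (_ : 0 < (q ^ n).-1)); last lia.
  by apply: leq_trans leM; rewrite Ek1 -[X in X < _]add0n ltn_add2r.
have EM : M = \sum_(a < n) (profile d w0 w1 a + k.-1) * q ^ a.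
  under eq_bigr do rewrite mulnDl.
  rewrite big_split -/M0 -big_distrr /=; apply/eqP.
  have q1_gt0 : 0 < q.-1 by lia.
  by rewrite -(eqn_pmul2l q1_gt0) Ek1 predn_exp mulnDr mulnCA.
apply: (proj2 (@profile_shift q n d w0 w1 q_gt1 d_gt0 ltdn w01 le10 le01 f k.-1 _ _ _ _ EM)).
- by lia.
- by [].
- move=> y x w z lt_yx lt_xw lt_wz lt_zn; rewrite -cardS /f; split; apply: leq_sum_arc => s;
    by have := ltjn s; have := leid s; rewrite /in_arc; lia.
- move=> d1 x z lt_xz lt_zn; rewrite -cardS /f -sum1_card -big_split.
  by apply: leq_sum => s _ /=; have := ltjn s; have := leid s; rewrite d1 /in_arc; lia.
Qed.

(** * Power sums and the trace in a finite field *)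

Import GRing.Theory Num.Theory.
Local Open Scope ring_scope.

Section FiniteField.
Variable K : finFieldType.

Lemma finField_unit_expr (y : K) : y != 0 -> y ^+ #|K|.-1 = 1.
Proof.
move=> y_neq0; apply: (mulfI y_neq0).
by rewrite -exprS prednK ?expf_card ?mulr1 // (ltn_trans _ (finNzRing_gt1 K)).
Qed.

(** If some unit a has a ^ k != 1, multiplication by a permutes the units and scales the sum by a ^
    k, so the sum vanishes. *)
Lemma sum_finField_expr k :
  \sum_(y : K | y != 0) y ^+ k = if (#|K|.-1 %| k)%N then -1 else 0.
Proof.
have K_gt1 := finNzRing_gt1 K.
have N_gt0 : (0 < #|K|.-1)%N by rewrite ltn_predRL.
have card_unit : #|[pred y : K | y != 0]| = #|K|.-1.
  by rewrite (eq_card (_ : _ =i predC1 0)) ?cardC1.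
case: ifPn => [/dvdnP[m ->] | ndvd].
  transitivity (\sum_(y : K | y != 0) (1 : K)).
    by apply: eq_bigr => y y0; rewrite mulnC exprM finField_unit_expr ?expr1n.
  rewrite sumr_const card_unit -[X in _ *+ X]subn1 mulrnBr ?(ltnW K_gt1) //.
  suff ->: 1 *+ #|K| = 0 :> K by rewrite sub0r.
  have [p _ pK] := finPcharP K; apply/eqP; rewrite -(dvdn_pcharf pK).
  rewrite (card_pprimeChar pK) dvdn_exp //.
  by move: K_gt1; rewrite {1}(card_pprimeChar pK); case: (logn _ _).
have [a a0 ak] : exists2 a : K, a != 0 & a ^+ k != 1.
  case: (pickP [pred y : K | (y != 0) && (y ^+ k != 1)]) => [a /andP[] | all1].
    by exists a.
  (* Otherwise all units would be roots of X ^ r - 1, with r = [k %% #|K|.-1] smaller than their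
     number. *)
  have r_gt0 : (0 < k %% #|K|.-1)%N by rewrite lt0n.
  suff roots : all (k %% #|K|.-1).-unity_root (enum [pred y : K | y != 0]).
    have := max_unity_roots r_gt0 roots (enum_uniq _).
    by rewrite -cardE card_unit leqNgt ltn_pmod.
  apply/allP => y.
  rewrite mem_enum inE => y0; apply/unity_rootP.
  have /negbT := all1 y; rewrite /= y0 negbK => /eqP <-.
  by rewrite {2}(divn_eq k #|K|.-1) exprD mulnC exprM finField_unit_expr // expr1n mul1r.
apply/eqP; have: (a ^+ k - 1) * \sum_(y : K | y != 0) y ^+ k == 0.
  rewrite mulrBl mul1r subr_eq0 mulr_sumr; apply/eqP.
  rewrite [RHS](reindex_inj (mulfI a0)); apply: eq_big => y.
    by rewrite mulf_eq0 negb_or a0.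
  by rewrite exprMn.
by rewrite mulf_eq0 subr_eq0 (negPf ak).
Qed.

Variables (q n : nat).
Hypotheses (n_gt0 : (0 < n)%N) (cardK : #|K| = (q ^ n)%N).

Lemma root_card_gt1 : (1 < q)%N.
Proof.
by have := finNzRing_gt1 K; rewrite cardK; case: q => [|[|]] //; rewrite ?exp0n ?exp1n.
Qed.

Let q_gt1 := root_card_gt1.

Lemma pchar_nat_root_card : [pchar K].-nat q.
Proof.
have [p p_pr pK] := finPcharP K; rewrite (eq_pnat _ (pcharf_eq pK)).
have: p.-nat #|K| by rewrite (card_pprimeChar pK) pnatX pnat_id.
by rewrite cardK pnatX eqn0Ngt n_gt0 orbF.
Qed.

(** By Pascal's rule, as 'C(q, k + 1) vanishes in K for k + 1 < q: compare coefficients in (1 + X) ^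
    q = 1 + X ^ q. *)
Lemma bin_pred_root_card k : (k < q)%N -> ('C(q.-1, k))%:R = (-1) ^+ k :> K.
Proof.
elim: k => [|k IHk] ltkq; first by rewrite bin0.
have E : ('C(q, k.+1))%:R = 0 :> K; last first.
  move: E; rewrite -{1}[q]prednK ?binS ?natrD ?IHk; try lia.
  by move/eqP; rewrite addr_eq0 exprS mulN1r => /eqP.
have qK : [pchar {poly K}].-nat q.
  by rewrite (eq_pnat _ (pchar_poly _)) pchar_nat_root_card.
have := exprDn_pchar 1 'X qK; move/(congr1 (coefp k.+1)).
rewrite /= coefD expr1n coef1 coefXn add0r.
rewrite exprDn coef_sum /= (ltn_eqF ltkq).
rewrite (bigD1 (Ordinal (ltnW ltkq : k.+1 < q.+1)%N)) //= big1 => [|i neq_i].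
  by rewrite expr1n mul1r coefMn coefXn eqxx addr0.
rewrite expr1n mul1r coefMn coefXn [k.+1 == _](_ : _ = false) ?mul0rn //.
by apply: contraNF neq_i => /eqP Ei; apply/eqP/val_inj.
Qed.

Lemma unit_expr_modn (y : K) j k : y != 0 -> y ^+ (k * q ^ j) = y ^+ (k * q ^ (j %% n)).
Proof.
move=> y0; have N_gt0 : (0 < q ^ n)%N by rewrite expn_gt0 ltnW.
rewrite {1}(divn_eq j n) expnD mulnA [(k * _)%N]mulnC -mulnA exprM; congr (_ ^+ _).
elim: (j %/ n)%N => [|m IHm]; first by rewrite mul0n.
by rewrite mulSn expnD exprM -cardK expf_card.
Qed.

(** The trace as a sum of Frobenius powers; [TrE] matches it with [Tr]. *)
Definition root_trace (x : K) := \sum_(j < n) x ^+ (q ^ j).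

Lemma expr_sum_pnat (I : Type) (r : seq I) (F : I -> K) m : [pchar K].-nat m ->
  (\sum_(i <- r) F i) ^+ m = \sum_(i <- r) F i ^+ m.
Proof.
move=> mK; have /andP[m_gt0 _] := mK; elim: r => [|i r IHr].
  by rewrite !big_nil expr0n gtn_eqF.
by rewrite !big_cons exprDn_pchar ?IHr.
Qed.

Lemma root_traceXq x : root_trace x ^+ q = root_trace x.
Proof.
rewrite /root_trace expr_sum_pnat ?pchar_nat_root_card //.
have := cardK; case: n n_gt0 => // m _ cardKm.
rewrite big_ord_recr [RHS]big_ord_recl /= addrC -exprM -expnSr -cardKm expf_card.
by congr (_ + _); apply: eq_bigr => j _; rewrite -exprM -expnSr.
Qed.

(** The trace is fixed by z |-> z ^ q, hence so is the nonzero element [root_trace x - 1]. *)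
Lemma root_trace_neq1 x : root_trace x != 1 -> (root_trace x - 1) ^+ q.-1 = 1.
Proof.
rewrite -subr_eq0 => T0; apply: (mulfI T0).
rewrite -exprS prednK ?mulr1; last exact: ltnW.
rewrite exprDn_pchar ?pchar_nat_root_card // root_traceXq -[- 1]mulN1r mulr1; congr (_ + _).
(* Expanding (1 - 1) ^ q gives (-1) ^ q = -1 whatever the parity of q. *)
apply/(addrI 1); rewrite -{1}(expr1n K q) -exprDn_pchar ?pchar_nat_root_card //.
by rewrite subrr expr0n; case: q q_gt1.
Qed.

Section Expansion.
Variables (d : nat) (c : 'I_d.+1 -> K).
Hypothesis ledn : (d <= n)%N.
Implicit Type u : option ('I_n * 'I_d.+1).

(* [Some (j, i)] indexes the monomial (c_i * y ^ (q ^ i - 1)) ^ (q ^ j) of the trace,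
   and [None] the constant -1, which gets the empty arc. *)
Definition term_start u : nat := if u is Some (j, _) then j else 0.
Definition term_length u : nat := if u is Some (_, i) then i else 0.
Definition term_coef u : K := if u is Some (j, i) then c i ^+ (q ^ j) else -1.
Definition term_weight u := (\sum_(a < n | in_arc n (term_start u) (term_length u) a) q ^ a)%N.

(** The exponent q ^ i - 1 is q - 1 times a number with digit 1 on [0, i); raising to the power q ^
    j rotates these digits by j, since y ^ (q ^ n) = y. *)
Lemma trace_ratio_expansion (y : K) : y != 0 ->
  root_trace ((linearised_poly q c).[y] / y) - 1
    = \sum_u term_coef u * y ^+ (q.-1 * term_weight u).
Proof.
move=> y0; have qK := pchar_nat_root_card.
have term (j : 'I_n) (i : 'I_d.+1) :
    (y ^+ (q ^ i) / y) ^+ (q ^ j) = y ^+ (q.-1 * term_weight (Some (j, i))).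
  have lein : (i <= n)%N by rewrite (leq_trans _ ledn) // -ltnS.
  have -> : y ^+ (q ^ i) / y = y ^+ (q ^ i).-1.
    by apply: (mulIf y0); rewrite mulfVK // -exprSr prednK // expn_gt0 ltnW.
  rewrite -exprM predn_exp /term_weight /= -(sum_arc (fun a => q ^ a)%N) //.
  rewrite -mulnA big_distrl !big_distrr -!prodrXr /=.
  by apply: eq_bigr => k _; rewrite -expnD addnC unit_expr_modn.
rewrite (bigD1 None) //= /term_weight big1 ?muln0 ?expr0 ?mulr1; last first.
  by move=> a; rewrite /in_arc /=; have := ltn_ord a; lia.
rewrite addrC; congr (_ + _).
rewrite (reindex_omap Some id) /=; last by case.
rewrite (eq_bigl predT); last by move=> u; rewrite /= eqxx.
transitivity (\sum_(j < n) \sum_(i < d.+1)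
    term_coef (Some (j, i)) * y ^+ (q.-1 * term_weight (Some (j, i)))); last first.
  by rewrite pair_bigA; apply: eq_bigr => -[].
apply: eq_bigr => j _; rewrite /linearised_poly horner_sum mulr_suml.
rewrite expr_sum_pnat ?pnatX ?qK //; apply: eq_bigr => i _.
by rewrite hornerZ hornerXn -mulrA exprMn term.
Qed.
End Expansion.
End FiniteField.

(** * Isolating one coefficient of the expansion *)

Lemma root_trace_ratio_eq1 (K : finFieldType) (q n d : nat) (c : 'I_d.+1 -> K) :
    #|K| = (q ^ n)%N -> (0 < d)%N -> (d.*2.+2 < n)%N -> c ord_max != 0 ->
  exists2 y : K, y != 0 & root_trace q n ((linearised_poly q c).[y] / y) = 1.
Proof.
move=> cardK d_gt0 ltdn c_neq0; have n_gt0 : (0 < n)%N by lia.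
have q_gt1 := root_card_gt1 n_gt0 cardK.
have ledn : (d <= n)%N by lia.
case: (pickP [pred y : K |
  (y != 0) && (root_trace q n ((linearised_poly q c).[y] / y) == 1)]).
  by move=> y /andP[y0 /eqP ?]; exists y.
move=> no_y; exfalso.
have no_y1 y : y != 0 -> root_trace q n ((linearised_poly q c).[y] / y) != 1.
  by move=> y0; have := no_y y; rewrite /= y0 /= => ->.
pose w0 := uphalf q.-1; pose w1 := (q.-1)./2.
have [w01 lew10 lew01] : [/\ w0 + w1 = q.-1, w1 <= w0 & w0 <= w1.+1]%N.
  by rewrite /w0 /w1; split; lia.
pose E := (q.-1 * \sum_(a < n) profile d w0 w1 a * q ^ a)%N.
have /andP[E_gt0 ltE] : (0 < E < (q ^ n).-1)%N by apply: profile_bounds; lia.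
(* Multiplying by y ^ m and summing over the units extracts the coefficient of y ^ E, up to sign. *)
pose m := ((q ^ n).-1 - E)%N.
pose S := 'I_q.-1; pose J := option ('I_n * 'I_d.+1).
pose cover (phi : {ffun S -> J}) a :=
  (\sum_s in_arc n (term_start (phi s)) (term_length (phi s)) a)%N.
have weightE (phi : {ffun S -> J}) :
    (\sum_s term_weight q (phi s) = \sum_(a < n) cover phi a * q ^ a)%N.
  rewrite /term_weight; under eq_bigr do rewrite big_mkcond.
  rewrite exchange_big; apply: eq_bigr => a _; rewrite big_distrl.
  by apply: eq_bigr => s _; rewrite /= mulnbl.
pose cf (phi : {ffun S -> J}) := \prod_s term_coef q c (phi s).
pose dv (phi : {ffun S -> J}) := ((q ^ n).-1 %| m + q.-1 * \sum_(a < n) cover phi a * q ^ a)%N.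
have [m_gt0 ltm] : (0 < m)%N /\ (m < (q ^ n).-1)%N.
  by rewrite /m; move: E_gt0 ltE; set N := (q ^ n).-1; lia.
have sum0 : \sum_(y : K | y != 0) y ^+ m = 0.
  by rewrite sum_finField_expr cardK gtnNdvd.
have expS (z : K) : z ^+ q.-1 = \prod_(s : S) z by rewrite prodr_const card_ord.
(* The factor 1 = (trace - 1) ^ (q - 1) is inserted and expanded; [phi] chooses a term in each of
   the q - 1 factors. *)
have sumE : \sum_(y : K | y != 0) y ^+ m = \sum_(phi : {ffun S -> J} | dv phi) - cf phi.
  transitivity (\sum_(y : K | y != 0) \sum_(phi : {ffun S -> J})
      cf phi * y ^+ (m + q.-1 * \sum_(a < n) cover phi a * q ^ a)).
    apply: eq_bigr => y y0.
    rewrite -[LHS]mulr1 -(root_trace_neq1 n_gt0 cardK (no_y1 y y0)).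
    rewrite trace_ratio_expansion // expS.
    rewrite bigA_distr_bigA mulr_sumr; apply: eq_bigr => phi _.
    rewrite big_split /= mulrCA exprD -weightE; congr (_ * (_ * _)).
    by rewrite big_distrr -prodrXr.
  rewrite exchange_big [RHS]big_mkcond; apply: eq_bigr => phi _.
  by rewrite -mulr_sumr sum_finField_expr cardK -/(dv phi); case: dv; rewrite ?mulrN1 ?mulr0.
have n_gt1 : (1 < n)%N by lia.
(* Factors in A take the arc [0, d), the others [1, d + 1). *)
pose phiA (A : {set S}) : {ffun S -> J} :=
  [ffun s => Some (if s \in A then Ordinal n_gt0 else Ordinal n_gt1, ord_max)].
have phiA_inj : injective phiA.
  move=> A B /ffunP eqAB; apply/setP => s.
  by have := eqAB s; rewrite !ffunE => -[]; case: (s \in A); case: (s \in B).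
have cardS : #|{: S}| = q.-1 by rewrite card_ord.
have sum_in (A : {set S}) : (\sum_s (s \in A) = #|A|)%N by rewrite -big_mkcond sum1_card.
have dvE phi : dv phi = (phi \in [set phiA A | A in [set A : {set S} | #|A| == w0]]).
  apply/idP/imsetP => [dv_phi | [A]].
    have lt_start s : (term_start (phi s) < n)%N.
      by rewrite /term_start; case: (phi s) => [[[]]|].
    have le_length s : (term_length (phi s) <= d)%N.
      by rewrite /term_length; case: (phi s) => [[j i]|] //; rewrite -ltnS.
    have cov := arcs_congr q_gt1 d_gt0 ltdn w01 lew10 lew01 cardS lt_start le_length dv_phi.
    rewrite -cardS in w01.
    have [ij sum_w0] := arcs_profile d_gt0 ltdn w01 lt_start le_length cov.
    exists [set s | term_start (phi s) == 0%N].
      rewrite inE -sum_in -sum_w0; apply/eqP/eq_bigr => s _.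
      by rewrite inE.
    apply/ffunP => s; rewrite ffunE inE; have := ij s.
    case: (phi s) => [[j i]|] /= [Ei lej1]; last lia.
    congr (Some (_, _)); apply: val_inj => //=.
    by case: eqP => /=; lia.
  rewrite inE => /eqP cardA ->; rewrite /dv.
  suff cov a : (a < n)%N -> cover (phiA A) a = profile d w0 w1 a.
    under eq_bigr => a _ do rewrite cov //.
    by rewrite -/E subnK // ltnW.
  move=> ltan; have cardA' : #|~: A| = w1.
    by apply: (@addnI w0); rewrite w01 -cardA cardsC cardS.
  rewrite /cover (bigID (mem A)) /= /profile.
  congr addn.
    transitivity (\sum_(s in A) (a < d))%N; last by rewrite sum_nat_const cardA.
    by apply: eq_bigr => s sA; rewrite ffunE sA /= /in_arc; lia.
  transitivity (\sum_(s in ~: A) (0 < a <= d))%N; last by rewrite sum_nat_const cardA'.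
  apply: eq_big => s; first by rewrite inE.
  by move=> sA; rewrite ffunE (negPf sA) /= /in_arc; lia.
pose v := c ord_max ^+ w0 * (c ord_max ^+ q) ^+ w1.
have cfE (A : {set S}) : #|A| = w0 -> cf (phiA A) = v.
  move=> cardA; have cardA' : #|~: A| = w1.
    by apply: (@addnI w0); rewrite w01 -cardA cardsC cardS.
  rewrite /cf (bigID (mem A)) /= /v; congr (_ * _).
    rewrite -cardA -prodr_const; apply: eq_bigr => s sA.
    by rewrite ffunE sA /= expn0 expr1.
  rewrite -cardA' -prodr_const; apply: eq_big => s; first by rewrite inE.
  by move=> sA; rewrite ffunE (negPf sA) /= expn1.
move: sumE; rewrite sum0 (eq_bigl _ _ dvE) big_imset; last by move=> A B _ _ /phiA_inj.
rewrite (eq_bigr (fun=> - v)) => [|A]; last by rewrite inE => /eqP /cfE ->.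
(* The 'C(q - 1, w0) sets A contribute equally. *)
rewrite sumr_const card_draws cardS => /eqP; rewrite eq_sym mulNrn oppr_eq0 -mulr_natr.
rewrite (bin_pred_root_card n_gt0 cardK); last lia.
by rewrite mulf_eq0 signr_eq0 orbF mulf_eq0 !expf_eq0 (negPf c_neq0) !andbF.
Qed.

(** * The Galois trace and the projective line *)

(** The Galois group is cyclic, generated by x |-> x ^ [#|F|], and its order is the degree. *)
Lemma TrE (F : finFieldType) (L : fieldExtType F) (x : finvect_type L) :
  Tr L x = root_trace #|F| (\dim {: L}) x.
Proof.
have [alpha gen_alpha alphaE] :=
  @finField_galois_generator F (finvect_type L) 1%AS {:finvect_type L}%AS (sub1v _).
rewrite dimv1 expn1 in alphaE.
have galG : galois 1 {:finvect_type L} by apply: finField_galois; apply: sub1v.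
have ordG : #|('Gal({:finvect_type L} / 1))%g| = \dim {:L}.
  by rewrite -galois_dim // dimv1 divn1.
rewrite (eqP gen_alpha) -orderE in ordG.
rewrite /Tr /galTrace (eqP gen_alpha) -ordG /root_trace.
have -> : (<[alpha]> = [set alpha ^+ j | j : 'I_#[alpha]])%g.
  apply/setP => g; apply/cycleP/imsetP => [[k ->]|[j _ ->]]; last by exists j.
  exists (Ordinal (ltn_pmod k (order_gt0 alpha))) => //.
  by rewrite /= expg_mod_order.
rewrite big_imset => [|i j _ _ /eqP]; last first.
  by rewrite cyclic.eq_expg_mod_order !modn_small ?ltn_ord // => /eqP/val_inj.
apply: eq_bigr => -[j _] _ /=; elim: j => [|j IHj]; first by rewrite expg0 gal_id.
by rewrite expgSr galM ?memvf // IHj alphaE ?memvf // expnSr exprM.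
Qed.

Theorem theorem6p7 (q n d : nat) (F : finFieldType) (L : fieldExtType F)
    (hq : #|F| = q) (hn : \dim {: L} = n) (hn1 : (1 <= n)%N)
    (c : 'I_d.+1 -> finvect_type L) (hc : c ord_max != 0)
    (hd1 : (1 <= d)%N) (hd : d%:R < n%:R / 2%:R - 1 :> rat) :
  trace_points L :&: graph_points (linearised_poly q c) != set0.
Proof.
have ltdn : (d.*2.+2 < n)%N.
  move: hd; rewrite ltrBrDr ltr_pdivlMr // natr1 -natrM ltr_nat; lia.
have cardL : #|finvect_type L| = (q ^ n)%N.
  by have := card_vspace {:finvect_type L}%VS; rewrite card_vspacef hq hn.
have [y y0 Ty] := root_trace_ratio_eq1 cardL hd1 ltdn hc.
(* With x = f(y) / y and trace 1, the vector (x, 1) is (f(y), y) divided by y. *)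
set x := (_ / y) in Ty; have TrLx : Tr L x = 1 by rewrite TrE hq hn.
have x0 : x != 0.
  apply: contra_eq_neq TrLx => ->.
  by rewrite /Tr raddf0 eq_sym oner_neq0.
apply/set0Pn; exists (proj_point (x, Tr L x)).
rewrite inE; apply/andP; split; apply/imsetP; first by exists x; rewrite ?inE.
exists y; rewrite ?inE //; apply/setP => w.
rewrite TrLx; apply/imsetP/imsetP => -[a /[!inE] a0 ->] /=.
  exists (a / y); first by rewrite inE mulf_neq0 ?invr_eq0.
  by rewrite mulr1 divfK // /x mulrA [a / y * _]mulrAC.
exists (a * y); first by rewrite inE mulf_neq0.
by rewrite mulr1 -mulrA [y * x]mulrC /x divfK.
Qed.
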